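(* Let $\{F^k\}_{k\in\mathbb{N}_0}$ be the pullback attractor of a non-autonomous iterated function system of similarities on $\mathbb{R}^d$ that satisfies the (generalised) Moran open-set condition. If \[ \inf\{\sigma_i:i\in\mathbb{N}\}=\sigma_*>0 \] and there exist constants $s>0$, $n_0\in\mathbb{N}$ and $L>0$ such that \[ L^{-1}\le\sum_{\alpha\in\mathcal{J}^{k,k+n}}\sigma_\alpha^s\le L\quad\text{for all }k\in\mathbb{N}\text{ and }n\ge n_0, \] then each set $F^k$ is equi-homogeneous with $\dim_{\rm A}F^k=s$.
   Context: $\mathbb{N}=\{1,2,\dots\}$, $\mathbb{N}_0=\mathbb{N}\cup\{0\}$. A non-autonomous iterated function system on $\mathbb{R}^d$ consists of contractions $f_i:\mathbb{R}^d\to\mathbb{R}^d$ ($i\in\mathbb{N}$) with $|f_i(x)-f_i(y)|\le\sigma_i|x-y|$ for all $x,y$, where $\sigma_i\in(0,1)$, and finite index sets $\mathcal{I}_k\subset\mathbb{N}$ ($k\in\mathbb{N}$). It is a system of similarities if this inequality is an equality for every $i$. For $k<l$ put $\mathcal{J}^{k,l}=\mathcal{I}_{k+1}\times\cdots\times\mathcal{I}_l$, and for a finite tuple $\alpha=(i_1,\dots,i_m)$ put $\sigma_\alpha=\sigma_{i_1}\cdots\sigma_{i_m}$. For $B\subseteq\mathbb{R}^d$ put $\mathcal{S}^k(B)=\bigcup_{i\in\mathcal{I}_{k+1}}f_i(B)$, $\mathcal{S}^{k,l}(B)=\mathcal{S}^k\circ\cdots\circ\mathcal{S}^{l-1}(B)$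 for $k<l$, and $\mathcal{S}^{k,k}(B)=B$. Hausdorff semi-distance: $\rho_H(X,Y)=\sup_{x\in X}\inf_{y\in Y}|x-y|$. A pullback attractor is a collection of sets $\{F^k\}_{k\in\mathbb{N}_0}$ in $\mathbb{R}^d$ such that (1) each $F^k$ is compact and the $F^k$ are uniformly bounded; (2) $F^k=\mathcal{S}^k(F^{k+1})$ for all $k$; (3) $\rho_H(\mathcal{S}^{k,l}(B),F^k)\to0$ as $l\to\infty$ for every $k$ and every bounded $B\subset\mathbb{R}^d$. Generalised Moran open-set condition: there is a uniformly bounded sequence of non-empty open sets $U^k\subset\mathbb{R}^d$ ($k\in\mathbb{N}_0$) such that (i) $\mathcal{S}^k(U^{k+1})\subseteq U^k$; (ii) $f_i(U^k)\cap f_j(U^k)=\emptyset$ for $i,j\in\mathcal{I}_k$, $i\ne j$; (iii) there is $\epsilon_0>0$ with $\lambda(U^k)\ge\epsilon_0$ for all $k\in\mathbb{N}_0$, where $\lambda$ is $d$-dimensional Lebesgue measure. $B_\delta(x)$ is the closed ball of radius $\delta$ and centre $x$, and $\mathcal{N}(A,\delta)$ is the minimum number of closed balls of radius $\delta$ with centres in $A$ whose union contains $A$. A set $F$ is equi-homogeneous if for all $\delta_0>0$ there exist $M\ge 1$ and $c_1,c_2>0$ such that $\sup_{x\in F}\mathcal{N}(B_\delta(x)\cap F,\rho)\le M\inf_{x\in F}\mathcal{N}(B_{c_1\delta}(x)\cap F,c_2\rho)$ for all $\delta,\rho$ with $0<\rho<\delta\le\delta_0$. The Assouad dimension $\dim_{\rm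 A}F$ is the infimum of all $s\in[0,\infty)$ such that for all $\delta_0>0$ there is $C>0$ with $\sup_{x\in F}\mathcal{N}(B_\delta(x)\cap F,\rho)\le C(\delta/\rho)^s$ for all $0<\rho<\delta\le\delta_0$. *)

(* Defs.v *)
From HB Require Import structures.
From mathcomp Require Import all_boot all_order all_algebra finmap.
From mathcomp Require Import all_classical all_reals all_analysis.

Set Implicit Arguments.
Unset Strict Implicit.
Unset Printing Implicit Defensive.

Import Order.TTheory GRing.Theory Num.Theory.
Import numFieldNormedType.Exports.

Local Open Scope classical_set_scope.
Local Open Scope ring_scope.

Section Euclidean.
Context {R : realType} {d : nat}.
Implicit Types (x y : 'rV[R]_d) (A B X Y F : set 'rV[R]_d).

(* The library norm `|x| on 'rV[R]_d is the sup norm: it induces the usual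
   topology and the usual bounded sets, but metric notions that depend on the
   norm itself (similarities, balls) need the Euclidean norm below. *)
Definition enorm x : R := Num.sqrt (\sum_(i < d) x ord0 i ^+ 2).

Definition ecball x (r : R) : set 'rV[R]_d := [set y | enorm (y - x) <= r].

(* Suprema of subsets of [0, +oo]: the outer maximum makes the supremum over
   an empty X equal to 0 rather than -oo. *)
Definition hausdorff_semidist X Y : \bar R :=
  maxe 0%E
    (ereal_sup [set ereal_inf [set (enorm (x - y))%:E | y in Y] | x in X]).

Definition closed_box (a b : 'rV[R]_d) : set 'rV[R]_d :=
  [set x | forall i : 'I_d, a ord0 i <= x ord0 i <= b ord0 i].

(* Lebesgue outer measure (infimum over countable covers by closed boxes); it
   is only applied to open sets, where it is the d-dimensional Lebesgue
   measure. *)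
Definition lebesgue_Rd A : \bar R :=
  ereal_inf [set (\sum_(k <oo) (\prod_(i < d)
                      ((ab k).2 ord0 i - (ab k).1 ord0 i))%:E)%E
    | ab in [set ab : nat -> 'rV[R]_d * 'rV[R]_d |
        (forall k i, (ab k).1 ord0 i <= (ab k).2 ord0 i) /\
        A `<=` \bigcup_k closed_box (ab k).1 (ab k).2]].

(* An infimum of natural numbers, hence a minimum when a finite cover exists,
   and +oo otherwise. *)
Definition covering_number A (r : R) : \bar R :=
  ereal_inf [set ((size c)%:R : R)%:E
    | c in [set c : seq 'rV[R]_d | (forall x, x \in c -> A x) /\
        A `<=` [set y | exists2 x, x \in c & ecball x r y]]].

Definition equi_homogeneous F : Prop :=
  forall delta0 : R, 0 < delta0 ->
  exists M c1 c2 : R, [/\ 1 <= M, 0 < c1, 0 < c2 &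
    forall delta rho : R, 0 < rho -> rho < delta -> delta <= delta0 ->
      (ereal_sup [set covering_number (ecball x delta `&` F) rho | x in F] <=
       M%:E * ereal_inf
         [set covering_number (ecball x (c1 * delta) `&` F) (c2 * rho)
         | x in F])%E].

Definition assouad_dim F : \bar R :=
  ereal_inf [set s%:E | s in [set s : R | 0 <= s /\
    forall delta0 : R, 0 < delta0 -> exists2 C : R, 0 < C &
      forall delta rho : R, 0 < rho -> rho < delta -> delta <= delta0 ->
        (ereal_sup [set covering_number (ecball x delta `&` F) rho | x in F] <=
         (C * (delta / rho) `^ s)%:E)%E]].

End Euclidean.

(* The maps are labelled by nat instead of {1, 2, ...}, a mere relabelling.
   The index sets I_k, k >= 1, keep their numbering; nifs_index 0 is unused. *)
Record nifs (R : realType) (d : nat) := Nifs {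
  nifs_map : nat -> 'rV[R]_d -> 'rV[R]_d;
  nifs_ratio : nat -> R;
  nifs_index : nat -> {fset nat};
  nifs_ratio01 : forall i, 0 < nifs_ratio i < 1;
  nifs_contraction : forall i x y,
    enorm (nifs_map i x - nifs_map i y) <= nifs_ratio i * enorm (x - y);
  nifs_index_nonempty : forall k, (0 < k)%N -> nifs_index k != fset0
}.

Section NIFS.
Context {R : realType} {d : nat} (S : nifs R d).
Implicit Types (B : set 'rV[R]_d) (F : nat -> set 'rV[R]_d).

Definition similarities : Prop := forall i x y,
  enorm (nifs_map S i x - nifs_map S i y) = nifs_ratio S i * enorm (x - y).

(* J^{k,k+n} = I_{k+1} x ... x I_{k+n} *)
Definition words (k n : nat) : set (n.-tuple nat) :=
  [set a | forall j : 'I_n, tnth a j \in nifs_index S (k + j).+1].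

Definition word_ratio (n : nat) (a : n.-tuple nat) : R :=
  \prod_(j < n) nifs_ratio S (tnth a j).

Definition nifs_op (k : nat) B : set 'rV[R]_d :=
  \bigcup_(i in [set i | i \in nifs_index S k.+1]) (nifs_map S i @` B).

(* S^k o ... o S^(k+n-1) *)
Fixpoint nifs_iter (k n : nat) B : set 'rV[R]_d :=
  if n is m.+1 then nifs_op k (nifs_iter k.+1 m B) else B.

(* S^{k,l}, meant for k <= l *)
Definition nifs_comp (k l : nat) B : set 'rV[R]_d := nifs_iter k (l - k) B.

Definition pullback_attractor F : Prop :=
  [/\ (forall k, compact (F k)) /\ bounded_set (\bigcup_k F k),
      forall k, F k = nifs_op k (F k.+1) &
      forall k B, bounded_set B ->
        hausdorff_semidist (nifs_comp k l B) (F k) @[l --> \oo] --> 0%E].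

Definition moran_open_set_condition : Prop :=
  exists U : nat -> set 'rV[R]_d,
  [/\ bounded_set (\bigcup_k U k),
      forall k, open (U k) /\ U k !=set0,
      forall k, nifs_op k (U k.+1) `<=` U k,
      forall k i j, (0 < k)%N ->
        i \in nifs_index S k -> j \in nifs_index S k -> i != j ->
        (nifs_map S i @` U k) `&` (nifs_map S j @` U k) = set0 &
      exists2 eps0 : R, 0 < eps0 &
        forall k, (eps0%:E <= lebesgue_Rd (U k))%E].

End NIFS.

Arguments words {R d} S k n _.

(* Main.v *)
From HB Require Import structures.
Require Import Defs.
From mathcomp Require Import all_boot all_order all_algebra finmap.
From mathcomp Require Import all_classical all_reals all_analysis.
From mathcomp Require Import ring lra.

(* Stop each word at the first letter where its ratio falls below t.  The
   stopped words from level k index pieces f_a(F^l) of F^k of diameter at most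
   of order t, and multiplicativity of the sums over J^{k,l} shows that there
   are t^(-s) of them up to a constant independent of k and t.  By the open-set
   condition the sets f_a(U^l) are disjoint, of volume comparable to t^d, so a
   ball of radius t meets boundedly many pieces.  Cutting F^k at scale delta,
   then each piece meeting B_delta(x) at relative scale rho/delta, bounds
   N(B_delta(x) /\ F^k, rho) above and below by multiples of (delta/rho)^s,
   uniformly in x; both conclusions follow.

   The volume comparison avoids d-dimensional Lebesgue measure: an open set of
   large outer measure contains finitely many disjoint balls r_i with large
   sum of r_i^d, similarities map balls onto balls, and disjoint balls in a
   large ball are compared by counting the points of a fine grid. *)

Set Implicit Arguments.
Unset Strict Implicit.
Unset Printing Implicit Defensive.

Import Order.TTheory GRing.Theory Num.Theory.
Import numFieldNormedType.Exports.

Local Open Scope classical_set_scope.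
Local Open Scope ring_scope.

(** * The Euclidean norm and similarities *)

Section EuclideanNorm.
Context {R : realType} {d : nat}.
Implicit Types x y z : 'rV[R]_d.

Definition dotp x y : R := \sum_(i < d) x ord0 i * y ord0 i.

Lemma dotpC x y : dotp x y = dotp y x.
Proof. by apply: eq_bigr => i _; rewrite mulrC. Qed.

Lemma dotpDl x y z : dotp (x + y) z = dotp x z + dotp y z.
Proof. by rewrite -big_split; apply: eq_bigr => i _; rewrite /= mxE mulrDl. Qed.

Lemma dotpZl a x y : dotp (a *: x) y = a * dotp x y.
Proof. by rewrite mulr_sumr; apply: eq_bigr => i _; rewrite mxE mulrA. Qed.

Lemma dotpNl x y : dotp (- x) y = - dotp x y.
Proof. by rewrite -scaleN1r dotpZl mulN1r. Qed.

Lemma dotp_ge0 x : 0 <= dotp x x.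
Proof. by apply: sumr_ge0 => i _; rewrite -expr2 sqr_ge0. Qed.

Lemma sqr_enorm x : enorm x ^+ 2 = dotp x x.
Proof.
rewrite sqr_sqrtr; last by apply: sumr_ge0 => i _; rewrite sqr_ge0.
by apply: eq_bigr => i _; rewrite expr2.
Qed.

Lemma enorm_ge0 x : 0 <= enorm x.
Proof. exact: sqrtr_ge0. Qed.

Lemma enormE x : enorm x = Num.sqrt (dotp x x).
Proof. by rewrite -sqr_enorm sqrtr_sqr ger0_norm ?enorm_ge0. Qed.

Lemma enorm0 : enorm (0 : 'rV[R]_d) = 0.
Proof. by rewrite enormE -(scale0r 0) dotpZl mul0r sqrtr0. Qed.

Lemma enormZ a x : enorm (a *: x) = `|a| * enorm x.
Proof.
by rewrite !enormE dotpZl dotpC dotpZl mulrA -expr2 sqrtrM ?sqr_ge0 ?sqrtr_sqr.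
Qed.

Lemma enormN x : enorm (- x) = enorm x.
Proof. by rewrite -scaleN1r enormZ normrN1 mul1r. Qed.

Lemma enorm_distC x y : enorm (x - y) = enorm (y - x).
Proof. by rewrite -enormN opprB. Qed.

Lemma coord_le_enorm x i : `|x ord0 i| <= enorm x.
Proof.
rewrite -(@ler_pXn2r _ 2) ?nnegrE ?enorm_ge0 // sqr_enorm /dotp (bigD1 i) //=.
rewrite real_normK ?num_real // -expr2 lerDl.
by apply: sumr_ge0 => j _; rewrite -expr2 sqr_ge0.
Qed.

Lemma enorm_eq0 x : enorm x = 0 -> x = 0.
Proof.
move=> x0; apply/rowP => i; rewrite mxE; apply/eqP.
by rewrite -normr_le0 -x0 coord_le_enorm.
Qed.

(** The crude factor d in place of sqrt d comes from d <= d^2; only comparisons up to constants are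
    needed later. *)
Lemma enorm_le_coord x b :
  (forall i, `|x ord0 i| <= b) -> enorm x <= d%:R * `|b|.
Proof.
move=> xb; rewrite -(@ler_pXn2r _ 2) ?nnegrE ?enorm_ge0 ?mulr_ge0 ?ler0n//.
rewrite sqr_enorm exprMn (@le_trans _ _ (\sum_(i < d) `|b| ^+ 2))//.
  apply: ler_sum => i _; rewrite -expr2 -real_normK ?num_real//.
  rewrite ler_pXn2r ?nnegrE//; exact: le_trans (xb i) (ler_norm b).
rewrite sumr_const card_ord -[leLHS]mulr_natl ler_wpM2r ?sqr_ge0//.
by rewrite -natrX ler_nat -mulnn; move: d => [|n] //; rewrite leq_pmulr.
Qed.

(** Cauchy-Schwarz: expand the squared norm of |y| x - |x| y and divide by |x| |y|. *)
Lemma dotp_le_enorm x y : dotp x y <= enorm x * enorm y.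
Proof.
have [->|x0] := eqVneq x 0.
  by rewrite -(scale0r 0) dotpZl mul0r enormZ normr0 !mul0r.
have [->|y0] := eqVneq y 0.
  by rewrite dotpC -(scale0r 0) dotpZl mul0r enormZ normr0 mul0r mulr0.
have pos z : z != 0 -> 0 < enorm z.
  by move=> z0; rewrite lt0r enorm_ge0 andbT; apply: contra_neq z0 => /enorm_eq0.
have nx := pos _ x0; have ny := pos _ y0.
have := dotp_ge0 (enorm y *: x - enorm x *: y).
rewrite !(dotpDl, dotpNl, dotpZl) !(dotpC _ (_ - _)) !(dotpDl, dotpNl, dotpZl).
rewrite -!sqr_enorm (dotpC y x) => ge0.
rewrite -(@ler_pM2l _ (enorm x * enorm y)) ?mulr_gt0//.
by lra.
Qed.

Lemma ler_enormD x y : enorm (x + y) <= enorm x + enorm y.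
Proof.
rewrite -(@ler_pXn2r _ 2) ?nnegrE ?addr_ge0 ?enorm_ge0//.
rewrite sqrrD !sqr_enorm dotpDl !(dotpC _ (_ + _)) !dotpDl (dotpC y x).
have := dotp_le_enorm x y; lra.
Qed.

Lemma ler_enorm_dist z x y : enorm (x - y) <= enorm (x - z) + enorm (z - y).
Proof. by rewrite (le_trans _ (ler_enormD _ _))// addrA subrK. Qed.

Lemma ler_enormB x y : enorm (x - y) <= enorm x + enorm y.
Proof. by rewrite (le_trans (ler_enormD _ _))// enormN. Qed.

Definition similarity (c : R) (f : 'rV[R]_d -> 'rV[R]_d) :=
  forall x y, enorm (f x - f y) = c * enorm (x - y).

Lemma similarity_inj c f : 0 < c -> similarity c f -> injective f.
Proof.
move=> c0 fc x y fxy; apply/eqP; rewrite -subr_eq0; apply/eqP/enorm_eq0.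
have := fc x y; rewrite fxy subrr enorm0 => /esym/eqP.
by rewrite mulf_eq0 gt_eqF//= => /eqP.
Qed.

(* After normalisation to g 0 = 0 and ratio 1, g preserves inner products, so
   the matrix A whose rows are the g(e_i) is orthogonal and g x = x *m A. *)
Lemma similarity_surj c f y : 0 < c -> similarity c f -> exists x, f x = y.
Proof.
move=> c0 fc; pose g x := c^-1 *: (f x - f 0).
have g0 : g 0 = 0 by rewrite /g subrr scaler0.
have gB x z : g x - g z = c^-1 *: (f x - f z).
  by rewrite /g -scalerBr opprB addrA subrK.
have gE x z : enorm (g x - g z) = enorm (x - z).
  by rewrite gB enormZ fc gtr0_norm ?invr_gt0// mulKf ?gt_eqF.
have gE0 x : enorm (g x) = enorm x by have := gE x 0; rewrite g0 !subr0.
have polar x z : dotp x z = (enorm x ^+ 2 + enorm z ^+ 2 - enorm (x - z) ^+ 2) / 2.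
  rewrite !sqr_enorm !(dotpDl, dotpNl) !(dotpC _ (_ - _)) !(dotpDl, dotpNl).
  by rewrite (dotpC z x); field.
have gdot x z : dotp (g x) (g z) = dotp x z by rewrite !polar gE !gE0.
have dote x i : dotp x (delta_mx 0 i) = x ord0 i.
  rewrite /dotp (bigD1 i)//= mxE !eqxx mulr1 big1 ?addr0// => j ji.
  by rewrite mxE eqxx (negbTE ji) mulr0.
pose A : 'M[R]_d := \matrix_(i, j) g (delta_mx 0 i) ord0 j.
(* The i-th coordinate on the left is the inner product of g x and g(e_i), which equals that of x
   and e_i. *)
have gA x : g x *m A^T = x.
  apply/rowP => i; rewrite mxE -[RHS]dote -gdot; apply: eq_bigr => j _.
  by rewrite !mxE.
have /mulmx1C AA : A *m A^T = 1%:M.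
  apply/row_matrixP => i; rewrite row_mul row1 -[RHS]gA; congr (_ *m _).
  by apply/rowP => j; rewrite !mxE.
have gx x : g x = x *m A by rewrite -{2}(gA x) -mulmxA AA mulmx1.
exists (c^-1 *: (y - f 0) *m A^T).
have : g (c^-1 *: (y - f 0) *m A^T) = c^-1 *: (y - f 0).
  by rewrite gx -mulmxA AA mulmx1.
move=> /(scalerI (invr_neq0 (lt0r_neq0 c0)))/eqP.
by rewrite subr_eq subrK => /eqP.
Qed.

(** Surjectivity is essential here: it lets a ball inside U produce a full ball inside the image of
    U. *)
Lemma ecball_similarity c f x r : 0 < c -> similarity c f ->
  ecball (f x) (c * r) `<=` f @` ecball x r.
Proof.
move=> c0 fc y; rewrite /ecball/= => yfx.
have [z fz] := similarity_surj y c0 fc; exists z => //=.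
by rewrite -(ler_pM2l c0) -fc fz.
Qed.

End EuclideanNorm.

(** * Packing balls by counting grid points *)

Section GridContent.
Context {R : realType} {d : nat}.
Implicit Types (x c : 'rV[R]_d) (V : set 'rV[R]_d) (K : R) (n : nat).

Definition grid_point x K n (g : {ffun 'I_d -> 'I_n.+1}) : 'rV[R]_d :=
  \row_i (x ord0 i - K + (2 * K / n%:R) * (g i)%:R).

Definition grid_count x K n V : nat := #|[pred g | `[< V (@grid_point x K n g) >]]|.

(* Lower d-dimensional content of V, up to the factor (2K)^d, measured by the
   n-th grids of the cube of centre x and half-side K. *)
Definition content_ge x K V (m : R) : Prop :=
  exists n0 : nat, forall n, (n0 <= n)%N -> m * n%:R ^+ d <= (grid_count x K n V)%:R.

(** Superadditivity: disjoint sets contain disjoint sets of grid points. The induction places the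
    remaining sets in [W] minus the first one; finitely many thresholds have a maximum. *)
Lemma content_ge_bigcup x K (J : eqType) (r : seq J) (V : J -> set 'rV[R]_d)
    (W : set 'rV[R]_d) (m : J -> R) :
  uniq r -> (forall j, j \in r -> content_ge x K (V j) (m j)) ->
  (forall j, j \in r -> V j `<=` W) ->
  (forall i j, i \in r -> j \in r -> i != j -> V i `&` V j = set0) ->
  content_ge x K W (\sum_(j <- r) m j).
Proof.
elim: r W => [|j r IH] W; first by exists 0%N => n _; rewrite big_nil mul0r ler0n.
move=> /=/andP[jr ur] cV VW dV.
have [n1 Hn1] := cV j (mem_head _ _).
have /IH[]// : forall i, i \in r -> V i `<=` W `\` V j.
  move=> i ir y Viy; split; first by apply: VW Viy; rewrite in_cons ir orbT.
  move=> Vjy; suff : (V i `&` V j) y by rewrite dV ?in_cons ?ir ?eqxx ?orbT//;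
    apply: contraNneq jr => <-.
  by [].
- by move=> i ir; apply: cV; rewrite in_cons ir orbT.
- by move=> i k ir kr ik; apply: dV; rewrite ?in_cons ?ir ?kr ?orbT.
move=> n2 Hn2; exists (maxn n1 n2) => n; rewrite geq_max => /andP[nn1 nn2].
rewrite big_cons mulrDl (le_trans (lerD (Hn1 _ nn1) (Hn2 _ nn2)))//.
rewrite -natrD ler_nat -cardUI -[leqRHS]addn0 leq_add//.
  apply: subset_leq_card; apply/fintype.subsetP => g; rewrite !inE.
  move=> /orP[] /asboolP Vg; last by case: Vg.
  exact: (VW j (mem_head _ _) _ Vg).
rewrite leqn0; apply/eqP/eq_card0 => g; rewrite !inE.
by apply/negP => /andP[/asboolP Vj /asboolP[]].
Qed.

(** The whole grid has (n+1)^d <= (2n)^d points once n >= 1. *)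
Lemma content_ge_le x K V m : content_ge x K V m -> m <= 2 ^+ d.
Proof.
move=> [n0 H]; have := H n0.+1 (leqnSn _); set n := n0.+1 => Hn.
have n0d : 0 < n%:R ^+ d :> R by rewrite exprn_gt0// ltr0n.
rewrite -(ler_pM2r n0d) (le_trans Hn)// -exprMn -natrM -natrX ler_nat.
apply: leq_trans (max_card _) _; rewrite card_ffun !card_ord.
have nn : (n.+1 <= 2 * n)%N by rewrite mul2n -addnn /n addSn ltnS leq_addl.
by elim: d => // k IH; rewrite !expnS leq_mul.
Qed.

(** The ball contains the cube of centre c and half-side h = r/d, whose grid points can be counted
    one axis at a time. *)
Lemma content_ge_ball x K c r : (0 < d)%N -> 0 < K -> 0 < r ->
  ecball c r `<=` ecball x K ->
  content_ge x K (ecball c r) ((r / (2 * d%:R * K)) ^+ d).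
Proof.
move=> d0 K0 r0 cx; pose h := r / d%:R.
have dR : 0 < d%:R :> R by rewrite ltr0n.
have h0 : 0 < h by rewrite divr_gt0.
have hr : h <= r by rewrite ler_pdivrMr// ler_peMr ?(ltW r0)// ler1n.
(* Moving from c along an axis by at most h <= r stays in the ball, so the inscribed cube lies in
   the cube that carries the grid. *)
have side (e : R) i : `|e| <= h -> `|c ord0 i + e - x ord0 i| <= K.
  move=> eh; have /cx : ecball c r (c + e *: delta_mx 0 i).
    rewrite /ecball/= addrC addKr enormZ.
    suff -> : enorm (delta_mx 0 i : 'rV[R]_d) = 1.
      by rewrite mulr1 (le_trans eh).
    rewrite enormE /dotp (bigD1 i)//= mxE !eqxx mulr1 big1 ?addr0 ?sqrtr1// => j ji.
    by rewrite mxE (negbTE ji) mulr0.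
  rewrite /ecball/= => /(le_trans (coord_le_enorm _ i)).
  by rewrite !mxE !eqxx mulr1.
(* From this n on the mesh [eta] is at most 2h: a side of the inscribed cube spans l >= 1 meshes,
   and the integer part q of l is at least l / 2. *)
exists (Num.trunc (K / h)).+1 => n nK.
have n0 : 0 < n%:R :> R by rewrite ltr0n (leq_trans _ nK).
pose eta := 2 * K / n%:R; have eta0 : 0 < eta by rewrite divr_gt0// mulr_gt0.
pose l := 2 * h / eta.
have l1 : 1 <= l.
  rewrite /l ler_pdivlMr// mul1r /eta -mulrA ler_pM2l// ler_pdivrMr//.
  rewrite mulrC -ler_pdivrMr// ltW// (lt_le_trans (truncnS_gt _))//.
  by rewrite ler_nat.
pose q := Num.trunc l.
have /andP[ql lq] : q%:R <= l < q.+1%:R by apply: truncn_itv; lra.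
have q1 : (0 < q)%N by rewrite -ltnS -(ltr_nat R) (le_lt_trans l1).
(* In grid units the i-th side is [a i, a i + l]. [A i] is the first index strictly above [a i], and
   the q indices starting there stay in this interval. *)
pose a i := (c ord0 i - h - x ord0 i + K) / eta.
have a0 i : 0 <= a i.
  rewrite divr_ge0 ?(ltW eta0)//.
  by have := side (- h) i; rewrite normrN gtr0_norm// lexx ler_norml; lra.
have al i : a i + l <= n%:R.
  rewrite -mulrDl ler_pdivrMr// [n%:R * _]mulrC /eta divfK ?gt_eqF//.
  by have := side h i; rewrite gtr0_norm// lexx ler_norml; lra.
pose A i := (Num.trunc (a i)).+1.
have aA i : a i < (A i)%:R <= a i + 1.
  by have := truncn_itv (a0 i); rewrite /A -[(_.+1)%:R]natr1; lra.
pose f (t : {ffun 'I_d -> 'I_q}) : {ffun 'I_d -> 'I_n.+1} :=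
  [ffun i => inord (A i + t i)].
have Atn (t : {ffun 'I_d -> 'I_q}) i : (A i + t i)%:R <= a i + l.
  rewrite natrD; have /andP[_ Ai] := aA i.
  have : (t i)%:R + 1 <= q%:R :> R by rewrite natr1 ler_nat ltn_ord.
  by lra.
have fE t i : f t i = (A i + t i)%N :> nat.
  by rewrite ffunE inordK// ltnS -(ler_nat R) (le_trans (Atn t i)).
have f_inj : injective f.
  move=> t u tu; apply/ffunP => i; apply/val_inj => /=.
  by apply: (@addnI (A i)); rewrite -!fE tu.
rewrite (@le_trans _ _ (q%:R ^+ d))//.
  rewrite -exprMn; apply: lerXn2r; rewrite ?nnegrE ?ler0n//.
    by rewrite mulr_ge0 ?ler0n// divr_ge0 ?(ltW r0)// !mulr_ge0// ltW.
  have -> : r / (2 * d%:R * K) * n%:R = l / 2.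
    rewrite /l /eta /h; field.
    by rewrite !gt_eqF.
  have : 1 <= q%:R :> R by rewrite ler1n.
  by move: lq; rewrite -natr1; lra.
have /esym qd := card_ffun 'I_d 'I_q; rewrite !card_ord in qd.
rewrite -natrX ler_nat qd -(card_codom f_inj).
apply: subset_leq_card; apply/fintype.subsetP => _ /codomP[t ->].
rewrite inE /ecball/=.
have -> : r = d%:R * `|h| by rewrite gtr0_norm// mulrC divfK ?gt_eqF.
apply: enorm_le_coord => i; rewrite !mxE fE.
have lo : a i <= (A i + t i)%:R.
  by rewrite natrD; have := aA i; have : 0 <= (t i)%:R :> R by []; lra.
have := ler_wpM2l (ltW eta0) (Atn t i); have := ler_wpM2l (ltW eta0) lo.
rewrite -/eta mulrDr.
have -> : eta * a i = c ord0 i - h - x ord0 i + K by rewrite mulrC divfK ?gt_eqF.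
have -> : eta * l = 2 * h by rewrite mulrC divfK ?gt_eqF.
rewrite ler_norml; lra.
Qed.

End GridContent.

(** * Dyadic cubes and disjoint balls inside an open set *)

Section DyadicCubes.
Context {R : realType} {d : nat}.
Implicit Types (x y : 'rV[R]_d) (m : nat) (U : set 'rV[R]_d).

(* (m, z) encodes the dyadic cube of side 2^-m with corners z/2^m, (z+1)/2^m. *)
Definition dyadic : Type := (nat * {ffun 'I_d -> int})%type.
HB.instance Definition _ := Countable.on dyadic.
Implicit Types t : dyadic.

Definition dside t : R := (2 ^+ t.1)^-1.
Definition dlo t : 'rV[R]_d := \row_i ((t.2 i)%:~R * dside t).
Definition dhi t : 'rV[R]_d := \row_i ((t.2 i + 1)%:~R * dside t).
Definition dcube t : set 'rV[R]_d := closed_box (dlo t) (dhi t).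
Definition dcenter t : 'rV[R]_d := \row_i (((t.2 i)%:~R + 2^-1) * dside t).

Definition dyadic_of m x : dyadic := (m, [ffun i => Num.floor (2 ^+ m * x ord0 i)]).

(** Closed cubes overlap along faces, so maximality refers to the coarser cubes of a point x of the
    half-open cell; these cells are the fibres of [dyadic_of]. Sides are at most 1, so the scales
    have a coarsest one. *)
Definition maximal_dyadic U t : Prop :=
  dcube t `<=` U /\ exists x, dyadic_of t.1 x = t /\
    forall m, (m < t.1)%N -> ~ dcube (dyadic_of m x) `<=` U.

Lemma dside_gt0 t : 0 < dside t.
Proof. by rewrite invr_gt0 exprn_gt0. Qed.

Lemma mem_dcube_of m x : dcube (dyadic_of m x) x.
Proof.
move=> i; rewrite !mxE /= !ffunE /dside/=.
have p2 : 0 < 2 ^+ m :> R by rewrite exprn_gt0.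
rewrite ler_pdivrMr// ler_pdivlMr// ![x _ _ * _]mulrC.
by have /andP[-> /ltW] := floor_itv (2 ^+ m * x ord0 i).
Qed.

Lemma dcube_small t x y i : dcube t x -> dcube t y ->
  `|x ord0 i - y ord0 i| <= dside t.
Proof.
move=> /(_ i) + /(_ i); rewrite !mxE intrD mulrDl mul1r => /andP[? ?] /andP[? ?].
by rewrite ler_norml; lra.
Qed.

(** Cells are nested: z <= 2^m c means z 2^(n-m) <= 2^n c, so the floor at scale n determines the
    floor at scale m. *)
Lemma dyadic_of_coarser m n x y : (m <= n)%N ->
  dyadic_of n x = dyadic_of n y -> dyadic_of m x = dyadic_of m y.
Proof.
move=> mn xy; congr pair; apply/ffunP => i; rewrite !ffunE.
have {xy}: Num.floor (2 ^+ n * x ord0 i) = Num.floor (2 ^+ n * y ord0 i).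
  by move: xy => /(congr1 snd)/ffunP/(_ i); rewrite !ffunE.
move: (x ord0 i) (y ord0 i) => a b ab.
wlog suff: a b ab / Num.floor (2 ^+ m * a) <= Num.floor (2 ^+ m * b).
  by move=> H; apply/le_anti; rewrite !H.
have scale (c : R) (z : int) :
    (z%:~R <= 2 ^+ m * c) = ((z * 2 ^+ (n - m))%:~R <= 2 ^+ n * c).
  rewrite -{2}(subnKC mn) exprD intrM rmorphXn/= mulrAC.
  by rewrite ler_pM2r ?exprn_gt0.
by rewrite floor_ge_int scale -floor_ge_int -ab floor_ge_int -scale floor_le.
Qed.

(** A quarter of the side is less than half of it, which keeps the ball off the faces and inside the
    half-open cell. *)
Lemma dyadic_of_ecball t y : ecball (dcenter t) (dside t / 4) y ->
  dyadic_of t.1 y = t.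
Proof.
have d0 := dside_gt0 t; case: t d0 => m z d0.
rewrite /ecball/= => yt; congr pair; apply/ffunP => i; rewrite ffunE.
apply: floor_def; have := le_trans (coord_le_enorm _ i) yt.
rewrite !mxE/= ler_norml mulrDl.
have p2 : 0 < 2 ^+ m :> R by rewrite exprn_gt0.
have -> : 2 ^+ m * y ord0 i = y ord0 i / dside (m, z) by rewrite invrK mulrC.
rewrite (ler_pdivlMr _ _ d0) (ltr_pdivrMr _ _ d0) intrD; lra.
Qed.

Lemma ecball_sub_dcube t : ecball (dcenter t) (dside t / 4) `<=` dcube t.
Proof. by move=> y /dyadic_of_ecball <-; exact: mem_dcube_of. Qed.

(** A common point would make the coarser cube an ancestor of the finer one; being contained in U,
    it would contradict the maximality of the finer. *)
Lemma maximal_dyadic_disjoint U t t' :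
  maximal_dyadic U t -> maximal_dyadic U t' -> t != t' ->
  ecball (dcenter t) (dside t / 4) `&` ecball (dcenter t') (dside t' / 4) = set0.
Proof.
wlog tt' : t t' / (t.1 <= t'.1)%N.
  move=> H Ut Ut' nt; have [tt'|/ltnW tt'] := leqP t.1 t'.1; first exact: H.
  by rewrite setIC H// eq_sym.
move=> [tU _] [_ [x [xt' xU]]] nt; apply/seteqP; split => // y.
move=> [/dyadic_of_ecball yt /dyadic_of_ecball yt'].
have xt : dyadic_of t.1 x = t.
  by rewrite -[RHS]yt; apply: (dyadic_of_coarser tt'); rewrite yt'.
move: tt'; rewrite leq_eqVlt => /orP[/eqP tt'|tt'].
  by move/eqP: nt; apply; rewrite -xt tt' xt'.
by apply: (xU _ tt'); rewrite xt.
Qed.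

(** Take the least scale at which the cube of x fits in U; small cubes fit because U is open. *)
Lemma maximal_dyadic_cover U x : open U -> U x ->
  exists t, maximal_dyadic U t /\ dcube t x.
Proof.
move=> oU Ux.
have /nbhs_ballP[e /= e0 eU] : nbhs x U by apply: open_nbhs_nbhs.
pose P m := `[< dcube (dyadic_of m x) `<=` U >].
have exP : exists m, P m.
  exists (Num.bound e^-1); apply/asboolP => y yx; apply: eU; split => // i j.
  rewrite ord1 /ball/= (le_lt_trans (dcube_small j (mem_dcube_of _ x) yx))//.
  by rewrite invf_plt ?posrE ?exprn_gt0//; apply: upper_nthrootP.
case: (ex_minnP exP) => m /asboolP mU minm.
exists (dyadic_of m x); split; last exact: mem_dcube_of.
split => //; exists x; split => // k km /asboolP/minm.
by rewrite leqNgt km.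
Qed.

(* The maximal dyadic cubes of U cover U, so their volumes add up to at least e
   and a finite subfamily already reaches e / 2. *)
Lemma open_dyadic U (e : R) : (0 < d)%N -> 0 < e -> open U ->
  (e%:E <= lebesgue_Rd U)%E ->
  exists r : seq dyadic, [/\ uniq r, forall t, t \in r -> maximal_dyadic U t &
    e / 2 <= \sum_(t <- r) dside t ^+ d].
Proof.
move=> d0 e0 oU eU; apply: contrapT => noU.
have small r : uniq r -> (forall t, t \in r -> maximal_dyadic U t) ->
    \sum_(t <- r) dside t ^+ d <= e / 2.
  move=> ur rU; rewrite leNgt; apply/negP => /ltW re; apply: noU.
  by exists r.
pose h k : option dyadic := if pickle_inv k is Some t then
  if `[< maximal_dyadic U t >] then Some t else None else None.
have hK : ocancel h choice.pickle.
  move=> k; rewrite /h; have := @pickle_invK dyadic k.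
  by case: (pickle_inv k) => //= t tk; case: ifP.
(* An index that codes no maximal cube gets the degenerate box at 0. Its volume is 0 because d > 0;
   for d = 0 the empty product would be 1. *)
pose ab k : 'rV[R]_d * 'rV[R]_d := oapp (fun t => (dlo t, dhi t)) (0, 0) (h k).
have volE k : \prod_(i < d) ((ab k).2 ord0 i - (ab k).1 ord0 i) =
    oapp (fun t => dside t ^+ d) 0 (h k).
  rewrite /ab; case: (h k) => [t|] /=.
    have -> : dside t ^+ d = \prod_(i < d) dside t by rewrite prodr_const card_ord.
    apply: eq_bigr => i _.
    by rewrite !mxE intrD mulrDl mul1r addrAC subrr add0r.
  by rewrite (bigD1 (Ordinal d0))//= subrr mul0r.
have vol0 k : 0 <= \prod_(i < d) ((ab k).2 ord0 i - (ab k).1 ord0 i).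
  by rewrite volE; case: (h k) => //= t; rewrite exprn_ge0// ltW// dside_gt0.
suff : (lebesgue_Rd U <= (e / 2)%:E)%E.
  by move=> /(le_trans eU); rewrite lee_fin; lra.
rewrite /lebesgue_Rd; apply: ge_ereal_inf; eexists; first exists ab.
- split=> [k i|x /(maximal_dyadic_cover oU)[t [tU tx]]].
    rewrite /ab; case: (h k) => [t|] //=.
    by rewrite !mxE intrD mulrDl mul1r lerDl ltW// dside_gt0.
  exists (choice.pickle t) => //.
  by rewrite /ab /h pickleK_inv; case: asboolP.
- by [].
apply: lime_le; first by apply: is_cvg_nneseries => k _ _; rewrite lee_fin.
apply: nearW => n; rewrite sumEFin lee_fin.
under eq_bigr do rewrite volE.
(* A partial sum of the series runs over a finite list of distinct maximal cubes. *)
rewrite -big_pmap; apply: small.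
  by apply: (pmap_uniq hK); exact: iota_uniq.
move=> t; rewrite mem_pmap => /mapP[k _]; rewrite /h.
by case: (pickle_inv k) => // t'; case: asboolP => // + [->].
Qed.
End DyadicCubes.

Lemma ler_size_sum (R : realDomainType) (J : eqType) (r : seq J) (F : J -> R) b :
  (forall j, j \in r -> b <= F j) -> (size r)%:R * b <= \sum_(j <- r) F j.
Proof.
elim: r => [|j r IH] bF; first by rewrite big_nil mul0r.
rewrite big_cons -natr1 mulrDl mul1r addrC lerD ?bF ?mem_head//.
by apply: IH => i ir; rewrite bF// in_cons ir orbT.
Qed.

(** * Volume comparison for disjoint similar copies of open sets *)

Section SimilarPacking.
Context {R : realType} {d : nat}.
Implicit Types (x y : 'rV[R]_d) (U : set 'rV[R]_d) (f : 'rV[R]_d -> 'rV[R]_d).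

Lemma content_geW x (K : R) U (m m' : R) : m' <= m ->
  content_ge x K U m -> content_ge x K U m'.
Proof.
move=> mm' [n0 H]; exists n0 => n /H; apply: le_trans.
by rewrite ler_wpM2r// exprn_ge0.
Qed.

(** The balls of radius a quarter of the side in the dyadic cubes of U are mapped onto disjoint
    balls; the 8 is this 4 times the 2 of [content_ge_ball]. *)
Lemma content_ge_similar_image x (K e c : R) f U :
  (0 < d)%N -> 0 < K -> 0 < e -> 0 < c -> similarity c f ->
  open U -> (e%:E <= lebesgue_Rd U)%E -> f @` U `<=` ecball x K ->
  content_ge x K (f @` U) ((c / (8 * d%:R * K)) ^+ d * (e / 2)).
Proof.
move=> d0 K0 e0 c0 fc oU eU fU.
have [r [ur rU er]] := open_dyadic d0 e0 oU eU.
have dR : 0 < d%:R :> R by rewrite ltr0n.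
pose b (t : @dyadic d) := ecball (f (dcenter t)) (c * (dside t / 4)) : set 'rV[R]_d.
have bf t : b t `<=` f @` ecball (dcenter t) (dside t / 4) by apply: ecball_similarity.
have bU t : t \in r -> b t `<=` f @` U.
  move=> /rU[tU _] y /bf[z tz <-]; exists z => //.
  by apply: tU; exact: ecball_sub_dcube.
have := @content_ge_bigcup _ _ x K _ r b (f @` U)
  (fun t => (c * (dside t / 4) / (2 * d%:R * K)) ^+ d) ur.
move/(_ _ bU _) => H.
have {}H : content_ge x K (f @` U)
    (\sum_(t <- r) (c * (dside t / 4) / (2 * d%:R * K)) ^+ d).
  apply: H => [t tr|t t' tr tr' tt'].
    apply: content_ge_ball => //; first by rewrite mulr_gt0// divr_gt0// dside_gt0.
    exact: (subset_trans (bU _ tr)).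
  apply/seteqP; split => // y [/bf[z tz <-] /bf[z' tz' zz']].
  have := maximal_dyadic_disjoint (rU _ tr) (rU _ tr') tt'.
  move/seteqP => [+ _] => /(_ z); apply; split => //.
  by rewrite -(similarity_inj c0 fc zz').
apply: content_geW H.
have c8 : 0 <= (c / (8 * d%:R * K)) ^+ d.
  by rewrite exprn_ge0// divr_ge0 ?mulr_ge0// ltW.
apply: le_trans (ler_wpM2l c8 er) _.
rewrite mulr_sumr le_eqVlt; apply/orP; left; apply/eqP.
apply: eq_bigr => t _; rewrite -exprMn; congr (_ ^+ _); field.
by rewrite !gt_eqF.
Qed.

(** The contents of the disjoint images add up to at most the total content 2^d; clearing
    denominators turns 8 into 16. *)
Lemma similar_packing x (K e : R) (J : eqType) (r : seq J)
    (f : J -> 'rV[R]_d -> 'rV[R]_d) (c : J -> R) (U : J -> set 'rV[R]_d) :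
  (0 < d)%N -> 0 < K -> 0 < e -> uniq r ->
  (forall j, j \in r -> 0 < c j /\ similarity (c j) (f j)) ->
  (forall j, j \in r -> open (U j) /\ (e%:E <= lebesgue_Rd (U j))%E) ->
  (forall j, j \in r -> f j @` U j `<=` ecball x K) ->
  (forall i j, i \in r -> j \in r -> i != j ->
     (f i @` U i) `&` (f j @` U j) = set0) ->
  e * (\sum_(j <- r) c j ^+ d) <= 2 * (16 * d%:R * K) ^+ d.
Proof.
move=> d0 K0 e0 ur fc Ue UK dU.
have dR : 0 < d%:R :> R by rewrite ltr0n.
have : content_ge x K setT
    (\sum_(j <- r) (c j / (8 * d%:R * K)) ^+ d * (e / 2)).
  apply: (content_ge_bigcup (V := fun j => f j @` U j)) => // j jr.
  have [cj fj] := fc _ jr; have [oU eU] := Ue _ jr.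
  exact: content_ge_similar_image (UK _ jr).
move=> /content_ge_le.
rewrite -mulr_suml => H.
have K8 : 0 < 8 * d%:R * K by rewrite !mulr_gt0.
have -> : \sum_(j <- r) c j ^+ d =
    (8 * d%:R * K) ^+ d * \sum_(j <- r) (c j / (8 * d%:R * K)) ^+ d.
  rewrite mulr_sumr; apply: eq_bigr => j _.
  by rewrite -exprMn [RHS]/= mulrC divfK ?gt_eqF.
have -> : 16 * d%:R * K = 2 * (8 * d%:R * K) by ring.
rewrite [(2 * _) ^+ d]exprMn.
move: (ler_wpM2l (exprn_ge0 d (ltW K8)) H).
move: (_ ^+ d) (\sum_(_ <- _) _) (2 ^+ d) => P X Q; lra.
Qed.

(** Ratios of at least a K turn the volume bound into a count in which K cancels, so the bound is
    the same at every scale. *)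
Lemma similar_packing_count x (K e a : R) (J : eqType) (r : seq J)
    (f : J -> 'rV[R]_d -> 'rV[R]_d) (c : J -> R) (U : J -> set 'rV[R]_d) :
  (0 < d)%N -> 0 < K -> 0 < e -> 0 < a -> uniq r ->
  (forall j, j \in r -> a * K <= c j /\ similarity (c j) (f j)) ->
  (forall j, j \in r -> open (U j) /\ (e%:E <= lebesgue_Rd (U j))%E) ->
  (forall j, j \in r -> f j @` U j `<=` ecball x K) ->
  (forall i j, i \in r -> j \in r -> i != j ->
     (f i @` U i) `&` (f j @` U j) = set0) ->
  (size r)%:R <= 2 * (16 * d%:R / a) ^+ d / e.
Proof.
move=> d0 K0 e0 a0 ur fc Ue UK dU.
have aK : 0 < (a * K) ^+ d by rewrite exprn_gt0// mulr_gt0.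
have : e * \sum_(j <- r) c j ^+ d <= 2 * (16 * d%:R * K) ^+ d.
  apply: (similar_packing d0 K0 e0 ur _ Ue UK) => // j /fc[cj fj]; split => //.
  by rewrite (lt_le_trans _ cj)// mulr_gt0.
move=> H.
have -> : 2 * (16 * d%:R / a) ^+ d = 2 * (16 * d%:R * K) ^+ d / (a * K) ^+ d.
  rewrite -[RHS]mulrA -expr_div_n; congr (_ * _ ^+ _); field.
  by rewrite !gt_eqF.
rewrite ler_pdivlMr// ler_pdivlMr//.
rewrite (le_trans _ H)// mulrAC mulrC ler_pM2l//.
apply: ler_size_sum => j /fc[cj _]; apply: lerXn2r; rewrite ?nnegrE//.
  by rewrite mulr_ge0 ?ltW.
by rewrite (le_trans _ cj)// mulr_ge0 ?ltW.
Qed.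
End SimilarPacking.

(** * Words and stopping sets *)

Section Words.
Context {R : realType} {d : nat} (S : nifs R d).
Implicit Types (k m n : nat) (w a b : seq nat) (s t : R).
Local Notation sigma := (nifs_ratio S).
Local Notation I k := (nifs_index S k).

Definition wmap w (x : 'rV[R]_d) : 'rV[R]_d := foldr (nifs_map S) x w.

Definition wratio w : R := \prod_(i <- w) sigma i.

Lemma ratio_gt0 i : 0 < sigma i.
Proof. by have /andP[] := nifs_ratio01 S i. Qed.

Lemma wratio_gt0 w : 0 < wratio w.
Proof. by apply: prodr_gt0 => i _; exact: ratio_gt0. Qed.

Lemma wratio_nil : wratio [::] = 1.
Proof. exact: big_nil. Qed.

Lemma wratio_cons i w : wratio (i :: w) = sigma i * wratio w.
Proof. exact: big_cons. Qed.

Lemma wratio_cat a b : wratio (a ++ b) = wratio a * wratio b.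
Proof. exact: big_cat. Qed.

Lemma wmap_cat a b x : wmap (a ++ b) x = wmap a (wmap b x).
Proof. exact: foldr_cat. Qed.

Lemma wmap_similarity w : similarities S -> similarity (wratio w) (wmap w).
Proof.
move=> simS; elim: w => [|i w IH] x y; first by rewrite wratio_nil mul1r.
by rewrite /= simS IH wratio_cons mulrA.
Qed.

Lemma wmap_inj w : similarities S -> injective (wmap w).
Proof. by move=> simS; exact: similarity_inj (wratio_gt0 w) (wmap_similarity w simS). Qed.

(** J^{k,k+n} as a duplicate-free list, so that sums over words obey a recursion on the first
    letter. *)
Fixpoint words_seq k n : seq (seq nat) :=
  if n is m.+1 then [seq i :: w | i <- I k.+1, w <- words_seq k.+1 m] else [:: [::]].

Lemma mem_words_seq k n w : w \in words_seq k n <->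
  size w = n /\ forall j, (j < n)%N -> nth 0%N w j \in I (k + j).+1.
Proof.
elim: n k w => [|n IH] k w /=.
  by rewrite mem_seq1; split=> [/eqP ->|[/size0nil ->]].
split=> [/allpairsPdep[i [a [iI aw ->]]]|].
  have /IH[sa Ha] := aw; split; first by rewrite /= sa.
  by move=> [|j] jn; rewrite ?addn0// addnS -addSn Ha.
case: w => [[]//|i w] [[sw] Hw]; apply/allpairsPdep; exists i, w; split => //.
  by have := Hw 0%N; rewrite addn0; apply.
apply/IH; split => // j jn; rewrite addSn -addnS.
exact: (Hw j.+1).
Qed.

Lemma words_seq_uniq k n : uniq (words_seq k n).
Proof.
elim: n k => //= n IH k; apply: allpairs_uniq_dep => //; first exact: fset_uniq.
by move=> [i a] [j b] _ _ /= [<- <-].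
Qed.

Definition wsum s k n : R := \sum_(w <- words_seq k n) wratio w `^ s.

Lemma fsum_wordsE s k n :
  \sum_(a \in words S k n) (word_ratio S a) `^ s = wsum s k n.
Proof.
pose r : seq (n.-tuple nat) := pmap insub (words_seq k n).
have wr w : w \in words_seq k n -> size w == n by move=> /mem_words_seq[->].
have -> : words S k n = [set` r].
  apply/seteqP; split=> a /=.
    move=> wa; rewrite mem_pmap; apply/mapP; exists (val a); last by rewrite valK.
    apply/mem_words_seq; split; first exact: size_tuple.
    by move=> j jn; have := wa (Ordinal jn); rewrite (tnth_nth 0%N).
  rewrite mem_pmap => /mapP[w /mem_words_seq[sw Hw]]; case: insubP => // u _ uw [->] j.
  by rewrite (tnth_nth 0%N) /= uw Hw.
rewrite -fsbig_seq; last by rewrite pmap_sub_uniq ?words_seq_uniq.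
rewrite big_pmap /wsum big_seq [RHS]big_seq; apply: eq_bigr => w /wr sw.
rewrite insubT /=; congr (_ `^ s).
exact: (esym (big_tuple _ _ (Tuple sw) xpredT sigma)).
Qed.

Lemma wsum0 s k : wsum s k 0 = 1.
Proof. by rewrite /wsum big_seq1 wratio_nil powR1. Qed.

Lemma wsumS s k n : wsum s k n.+1 = \sum_(i <- I k.+1) sigma i `^ s * wsum s k.+1 n.
Proof.
rewrite /wsum big_allpairs_dep /=; apply: eq_bigr => i _; rewrite mulr_sumr.
by apply: eq_bigr => w _; rewrite wratio_cons powRM// ltW ?ratio_gt0 ?wratio_gt0.
Qed.

(** Words split at position m into two independent parts, and ratios are multiplicative. *)
Lemma wsum_add s k m n : wsum s k (m + n) = wsum s k m * wsum s (k + m) n.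
Proof.
elim: m k => [|m IH] k; first by rewrite wsum0 mul1r addn0.
rewrite addSn !wsumS mulr_suml; apply: eq_bigr => i _.
by rewrite IH mulrA addSn addnS.
Qed.

Lemma wsum_gt0 s k n : 0 < wsum s k n.
Proof.
elim: n k => [|n IH] k; first by rewrite wsum0.
rewrite wsumS; have /fset0Pn[i iI] := nifs_index_nonempty S (ltn0Sn k).
rewrite (bigD1_seq i) ?fset_uniq//= ltr_pwDl ?mulr_gt0 ?powR_gt0 ?ratio_gt0//.
by apply: sumr_ge0 => j _; rewrite mulr_ge0 ?powR_ge0// ltW.
Qed.

(** Removes the restrictions on k and n. For k > 0, a sum of any length n is the quotient of two
    controlled sums, of lengths n + n0 and n0. *)
Lemma wsum_bounds s (n0 : nat) (L : R) : 0 < L ->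
  (forall k n, (0 < k)%N -> (n0 <= n)%N -> L^-1 <= wsum s k n <= L) ->
  exists2 M : R, 1 <= M & forall k n, M^-1 <= wsum s k n <= M.
Proof.
move=> L0 HL.
have HL1 k n : (0 < k)%N -> (L ^+ 2)^-1 <= wsum s k n <= L ^+ 2.
  move=> k0; have /andP[l1 l2] := HL k (n + n0)%N k0 (leq_addl _ _).
  have /andP[r1 r2] := HL (k + n)%N n0 (ltn_addr _ k0) (leqnn _).
  rewrite wsum_add in l1 l2.
  have Li : 0 < L^-1 by rewrite invr_gt0.
  have x0 := wsum_gt0 s k n; have y0 := wsum_gt0 s (k + n) n0.
  apply/andP; split.
    rewrite expr2 invfM ler_pdivrMr// (le_trans l1)// ler_wpM2l// ltW//.
  by rewrite expr2 -ler_pdivrMr// (le_trans _ l2)// ler_wpM2l// ltW.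
(* Level 0 is outside the hypothesis: its sums are [P] times sums from level 1, and [M] absorbs [P]
   and its inverse. *)
pose P := wsum s 0 1; have P0 : 0 < P := wsum_gt0 _ _ _.
pose M := 1 + L ^+ 2 + P * L ^+ 2 + P^-1 * L ^+ 2.
have LL : 0 < L ^+ 2 by rewrite exprn_gt0.
have Pi : 0 < P^-1 by rewrite invr_gt0.
have := mulr_gt0 P0 LL; have := mulr_gt0 Pi LL => h1 h2.
have M1 : 1 <= M by rewrite /M; lra.
have M0 : 0 < M by lra.
exists M => // k n.
have inv (x : R) : 0 < x -> x^-1 <= M -> M^-1 <= x.
  by move=> x0 xM; rewrite -(invrK x) lef_pV2 ?posrE ?invr_gt0.
case: k => [|k].
  case: n => [|n]; first by rewrite wsum0 M1 invf_le1// M1.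
  rewrite -add1n wsum_add -/P add0n.
  have /andP[a1 a2] := HL1 1%N n isT; have x0 := wsum_gt0 s 1 n.
  apply/andP; split.
    apply: inv; first exact: mulr_gt0.
    rewrite invfM (@le_trans _ _ (P^-1 * L ^+ 2))//; last by rewrite /M; lra.
    by rewrite ler_pM2l// -(invrK (L ^+ 2)) lef_pV2 ?posrE ?invr_gt0.
  rewrite (@le_trans _ _ (P * L ^+ 2))//; last by rewrite /M; lra.
  by rewrite ler_pM2l.
have /andP[a1 a2] := HL1 k.+1 n isT; have x0 := wsum_gt0 s k.+1 n.
apply/andP; split; last by rewrite (le_trans a2)// /M; lra.
apply: inv => //; rewrite (@le_trans _ _ (L ^+ 2))//; last by rewrite /M; lra.
by rewrite -(invrK (L ^+ 2)) lef_pV2 ?posrE ?invr_gt0.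
Qed.

(* The words at which the ratio first drops to t or below, truncated at depth n. *)
Fixpoint cut_words n k t : seq (seq nat) :=
  if n is m.+1 then
    if t < 1 then [seq i :: a | i <- I k.+1, a <- cut_words m k.+1 (t / sigma i)]
    else [:: [::]]
  else [:: [::]].

Lemma cut_uniq n k t : uniq (cut_words n k t).
Proof.
elim: n k t => //= n IH k t; case: ifP => // _.
apply: allpairs_uniq_dep => //; first exact: fset_uniq.
by move=> [i a] [j b] _ _ /= [<- <-].
Qed.

(** Every word of length n extends exactly one stopped word; the inner factor sums over the
    extensions. *)
Lemma cut_wsum s n k t :
  \sum_(a <- cut_words n k t) wratio a `^ s * wsum s (k + size a) (n - size a) = wsum s k n.
Proof.
have root k' n' : \sum_(a <- [:: [::]]) wratio a `^ s *
    wsum s (k' + size a) (n' - size a) = wsum s k' n'.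
  by rewrite big_seq1 wratio_nil powR1 mul1r addn0 subn0.
elim: n k t => [|n IH] k t //=; case: ifP => // _.
rewrite big_allpairs_dep wsumS /=; apply: eq_bigr => i _.
rewrite -(IH _ (t / sigma i)) mulr_sumr; apply: eq_bigr => a _.
by rewrite wratio_cons powRM ?mulrA ?addSn ?addnS// ltW ?ratio_gt0 ?wratio_gt0.
Qed.

(** Before its last letter a stopped word has ratio above t, and that letter costs at most a factor
    [sm]. The condition sm t <= 1 covers the empty word and survives the rescaling of t. *)
Lemma cut_ratio_ge (sm : R) n k t a : 0 < sm -> (forall i, sm <= sigma i) ->
  sm * t <= 1 -> a \in cut_words n k t -> sm * t <= wratio a.
Proof.
move=> sm0 smi; elim: n k t a => [|n IH] k t a t1 /=.
  by rewrite mem_seq1 => /eqP ->; rewrite wratio_nil.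
case: ifPn => [tl1|_]; last by rewrite mem_seq1 => /eqP ->; rewrite wratio_nil.
move=> /allpairsPdep[i [b [_ bc ->]]]; rewrite wratio_cons -ler_pdivrMl ?ratio_gt0//.
rewrite mulrC -mulrA; apply: IH bc.
rewrite mulrA ler_pdivrMr ?ratio_gt0// mul1r (le_trans _ (smi i))//.
by rewrite ler_piMr// ltW.
Qed.

(** The hypothesis makes the depth n large enough for the truncation to be harmless. *)
Lemma cut_ratio_le n k t a : (forall w, w \in words_seq k n -> wratio w <= t) ->
  a \in cut_words n k t -> wratio a <= t.
Proof.
elim: n k t a => [|n IH] k t a wt /=.
  by rewrite mem_seq1 => /eqP ->; apply: wt.
case: ifPn => [tl1|]; last by rewrite -leNgt mem_seq1 => ? /eqP ->; rewrite wratio_nil.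
move=> /allpairsPdep[i [b [iI bc ->]]].
rewrite wratio_cons mulrC -ler_pdivlMr ?ratio_gt0//.
apply: IH bc => w wn; rewrite ler_pdivlMr ?ratio_gt0// mulrC -wratio_cons.
by apply: wt; apply/allpairsPdep; exists i, w.
Qed.

Lemma cut_image_sub n k t a (B : nat -> set 'rV[R]_d) :
  (forall j, nifs_op S j (B j.+1) `<=` B j) ->
  a \in cut_words n k t -> wmap a @` B (k + size a)%N `<=` B k.
Proof.
move=> opB; elim: n k t a => [|n IH] k t a /=.
  by rewrite mem_seq1 => /eqP -> x [y + <-]; rewrite addn0.
case: ifP => _; last by rewrite mem_seq1 => /eqP -> x [y + <-]; rewrite addn0.
move=> /allpairsPdep[i [b [iI bc ->]]] x [y By <-]; apply: opB.
exists i => //; exists (wmap b y) => //; apply: (IH _ _ _ bc).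
by exists y => //; rewrite addSnnS.
Qed.

Lemma cut_cover n k t (F : nat -> set 'rV[R]_d) x :
  (forall j, F j `<=` nifs_op S j (F j.+1)) -> F k x ->
  exists2 a, a \in cut_words n k t & (wmap a @` F (k + size a)%N) x.
Proof.
move=> opF; elim: n k t x => [|n IH] k t x Fx /=.
  by exists [::] => //; exists x => //; rewrite addn0.
case: ifP => _; last by exists [::] => //; exists x => //; rewrite addn0.
have [i iI [y Fy <-]] := opF _ _ Fx.
have [b bc [z Fz <-]] := IH _ (t / sigma i) _ Fy.
exists (i :: b); first by apply/allpairsPdep; exists i, b.
by exists z => //; rewrite /= -addSnnS.
Qed.

(** No stopped word is a proper prefix of another, so a and b differ at some first letter. There the
    open-set condition separates the images; the common prefix is removed by injectivity. *)
Lemma cut_disjoint n k t a b (U : nat -> set 'rV[R]_d) :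
  similarities S ->
  (forall j, nifs_op S j (U j.+1) `<=` U j) ->
  (forall j i i', (0 < j)%N -> i \in I j -> i' \in I j -> i != i' ->
     (nifs_map S i @` U j) `&` (nifs_map S i' @` U j) = set0) ->
  a \in cut_words n k t -> b \in cut_words n k t -> a != b ->
  (wmap a @` U (k + size a)%N) `&` (wmap b @` U (k + size b)%N) = set0.
Proof.
move=> simS opU dU; elim: n k t a b => [|n IH] k t a b /=.
  by rewrite !mem_seq1 => /eqP -> /eqP ->; rewrite eqxx.
case: ifP => _; last by rewrite !mem_seq1 => /eqP -> /eqP ->; rewrite eqxx.
move=> /allpairsPdep[i [a' [iI ac ->]]] /allpairsPdep[j [b' [jI bc ->]]] ab.
apply/seteqP; split => // x [[y Uy <-] [z Uz]] /= zy.
rewrite /= addnS -addSn in Uy; rewrite /= addnS -addSn in Uz.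
have [ij|ij] := eqVneq i j.
  rewrite -ij in bc zy ab.
  have ab' : a' != b' by apply: contraNneq ab => ->.
  have /seteqP[+ _] := IH _ _ _ _ ac bc ab'; move/(_ (wmap a' y)); apply; split.
    by exists y.
  exists z => //; apply: (similarity_inj (ratio_gt0 i)); last exact: zy.
  by move=> u v; rewrite simS.
have /seteqP[+ _] := dU _ _ _ (ltn0Sn k) iI jI ij.
move/(_ (nifs_map S i (wmap a' y))); apply; split.
  by exists (wmap a' y) => //; apply: (cut_image_sub opU ac); exists y.
by exists (wmap b' z) => //; apply: (cut_image_sub opU bc); exists z.
Qed.

End Words.

(** * Covering numbers of the attractor *)

Section Attraction.
Context {R : realType} {d : nat}.
Implicit Types (x y : 'rV[R]_d) (A B : set 'rV[R]_d).

Lemma coord_le_norm x i : `|x ord0 i| <= `|x|.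
Proof. by rewrite [leRHS]mx_normrE (le_bigmax _ _ (ord0, i)). Qed.

Lemma bounded_set_enorm A : bounded_set A ->
  exists2 M : R, 0 <= M & forall x, A x -> enorm x <= M.
Proof.
move=> [m [_ Am]]; exists (d%:R * `|m + 1|); first by rewrite mulr_ge0.
move=> x Ax; apply: enorm_le_coord => i.
by rewrite (le_trans (coord_le_norm x i))// Am// ltrDl.
Qed.

Context (S : nifs R d) (F : nat -> set 'rV[R]_d).
Context (F_attractor : pullback_attractor S F).

Lemma attractor_near k B (e : R) : bounded_set B -> 0 < e ->
  exists n, forall x, nifs_iter S k n B x -> exists2 y, F k y & enorm (x - y) < e.
Proof.
move=> bB e0; have [_ _ /(_ k B bB) cvF] := F_attractor.
have /cvF : nbhs (0%E : \bar R) [set z | (z < e%:E)%E].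
  by apply: open_nbhs_nbhs; split; [exact: open_ereal_lt_ereal|rewrite /= lte_fin].
move=> [l _ Hl]; exists l => x.
have := Hl (k + l)%N (leq_addl _ _); rewrite /= /hausdorff_semidist /nifs_comp addKn.
rewrite gt_max => /andP[_ H] Bx.
have : (ereal_inf [set (enorm (x - y))%:E | y in F k] < e%:E)%E.
  by apply: le_lt_trans H; apply: ereal_sup_ubound; exists x.
by move=> /ereal_inf_lt[_ [y Fy <-]]; rewrite lte_fin; exists y.
Qed.

Lemma nifs_iter_words k n B w x : w \in words_seq S k n -> B x ->
  nifs_iter S k n B (wmap S w x).
Proof.
elim: n k w => [|n IH] k w /=; first by rewrite mem_seq1 => /eqP ->.
move=> /allpairsPdep[i [a [iI aw ->]]] Bx.
by exists i => //; exists (wmap S a x) => //; exact: IH.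
Qed.

Lemma words_seq_nonempty k n : exists w, w \in words_seq S k n.
Proof.
case E : (words_seq S k n) => [|w r]; last by exists w; exact: mem_head.
by have := wsum_gt0 S 1 k n; rewrite /wsum E big_nil ltxx.
Qed.

Lemma bounded_pair x y : bounded_set [set x; y].
Proof.
exists (`|x| + `|y|); split; first exact: num_real.
move=> M /ltW xyM z /= zxy; apply: le_trans xyM.
by case: zxy => ->; rewrite ?lerDl ?lerDr.
Qed.

(** The semi-distance from a non-empty set to the empty set is infinite and cannot tend to 0. *)
Lemma attractor_nonempty k : F k !=set0.
Proof.
have [n Hn] := attractor_near k (bounded_pair 0 0) ltr01.
have [w wn] := words_seq_nonempty k n.
have [|y Fy _] := Hn (wmap S w 0); last by exists y.
by apply: nifs_iter_words => //; left.
Qed.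

(* Two points at distance c have images at distance c * wratio w under f_w, yet
   these images approach the bounded set F k; so the ratios tend to 0. *)
Lemma attractor_ratio_small k (t : R) : (0 < d)%N -> similarities S -> 0 < t ->
  exists n, forall w, w \in words_seq S k n -> wratio S w <= t.
Proof.
move=> d0 simS t0.
have [[_ /bounded_set_enorm[M M0 FM]] _ _] := F_attractor.
(* Two approximation errors of 1 and the diameter bound 2M of [F k] give ratio times c at most 2 +
   2M, which is c t. *)
pose c := (2 + 2 * M) / t; have c0 : 0 < c by rewrite divr_gt0//; lra.
pose v : 'rV[R]_d := c *: delta_mx 0 (Ordinal d0).
have vc : enorm v = c.
  rewrite enormZ gtr0_norm// enormE /dotp (bigD1 (Ordinal d0))//= mxE !eqxx mulr1.
  rewrite big1 ?addr0 ?sqrtr1 ?mulr1// => j ji.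
  by rewrite mxE (negbTE ji) mulr0.
have [n Hn] := attractor_near k (bounded_pair 0 v) ltr01.
exists n => w wn.
have [|y Fy y1] := Hn (wmap S w 0); first by apply: nifs_iter_words => //; left.
have [|z Fz z1] := Hn (wmap S w v); first by apply: nifs_iter_words => //; right.
have : wratio S w * c <= 2 + 2 * M.
  have := wmap_similarity w simS v 0; rewrite subr0 vc => <-.
  have := ler_enorm_dist z (wmap S w v) (wmap S w 0).
  have := ler_enorm_dist y z (wmap S w 0).
  have := ler_enormB z y; rewrite (enorm_distC y (wmap S w 0)).
  have : enorm z <= M by apply: FM; exists k.
  have : enorm y <= M by apply: FM; exists k.
  lra.
by rewrite -ler_pdivlMr// /c invf_div mulrCA mulfV ?mulr1//; lra.
Qed.

End Attraction.

(** Double counting of the related pairs. *)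
Lemma size_le_sum_count (T1 T2 : eqType) (P : T1 -> pred T2) (c : seq T1) (r : seq T2) :
  (forall b, b \in r -> exists2 y, y \in c & P y b) ->
  (size r <= \sum_(y <- c) count (P y) r)%N.
Proof.
move=> H; under eq_bigr do rewrite -sum1_count.
rewrite (exchange_big_dep xpredT)//= -sum1_size big_seq [leqRHS]big_seq.
apply: leq_sum => b /H[y yc Pyb].
by rewrite sum1_count -has_count; apply/hasP; exists y.
Qed.

(** * Stopping sets and two-sided bounds for covering numbers *)

Section Covering.
Context {R : realType} {d : nat} (d0 : (0 < d)%N) (S : nifs R d).
Context (F U : nat -> set 'rV[R]_d) (D eps sm s M : R).
Context (simS : similarities S).
Context (F_op : forall k, F k = nifs_op S k (F k.+1)).
Context (F_neq0 : forall k, F k !=set0).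
Context (small : forall k (t : R), 0 < t ->
  exists n, forall w, w \in words_seq S k n -> wratio S w <= t).
Context (U_open : forall k, open (U k)).
Context (U_op : forall k, nifs_op S k (U k.+1) `<=` U k).
Context (U_disj : forall k i j, (0 < k)%N -> i \in nifs_index S k ->
  j \in nifs_index S k -> i != j ->
  (nifs_map S i @` U k) `&` (nifs_map S j @` U k) = set0).
Context (eps0 : 0 < eps) (U_eps : forall k, (eps%:E <= lebesgue_Rd (U k))%E).
Context (D1 : 1 <= D).
Context (FF_D : forall k x y, F k x -> F k y -> enorm (x - y) <= D).
Context (UF_D : forall k x y, U k x -> F k y -> enorm (x - y) <= D).
Context (sm0 : 0 < sm) (sm_le : forall i, sm <= nifs_ratio S i).
Context (s0 : 0 < s) (M1 : 1 <= M).
Context (wsum_M : forall k n, M^-1 <= wsum S s k n <= M).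

Let D0 : 0 < D. Proof. exact: lt_le_trans ltr01 D1. Qed.
Let M0 : 0 < M. Proof. exact: lt_le_trans ltr01 M1. Qed.

Record stopping_set k (t : R) (C : seq (seq nat)) : Prop := StoppingSet {
  stop_uniq : uniq C;
  stop_ratio : forall a, a \in C -> sm * t <= wratio S a <= t;
  stop_card_le : (size C)%:R * (sm * t) `^ s <= M ^+ 2;
  stop_card_ge : (M ^+ 2)^-1 <= (size C)%:R * t `^ s;
  stop_cover : forall x, F k x ->
    exists2 a, a \in C & (wmap S a @` F (k + size a)%N) x;
  stop_sub : forall a, a \in C -> wmap S a @` F (k + size a)%N `<=` F k;
  stop_disj : forall a b, a \in C -> b \in C -> a != b ->
    (wmap S a @` U (k + size a)%N) `&` (wmap S b @` U (k + size b)%N) = set0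
}.

(** For the cardinality, [cut_wsum] writes a number in [1/M, M] as a sum over the cut whose terms
    lie between (sm t)^s / M and t^s M. *)
Lemma stopping_set_exists k t : 0 < t -> t <= 1 -> exists C, stopping_set k t C.
Proof.
move=> t0 t1; have [n Hn] := small k t0.
have smt : sm * t <= 1.
  have /andP[_ /ltW] := nifs_ratio01 S 0; have := sm_le 0 => h1 h2.
  by apply: mulr_ile1; rewrite ?(ltW sm0) ?(ltW t0)// (le_trans h1 h2).
have smt0 : 0 <= sm * t by rewrite mulr_ge0// ltW.
have ratioC a : a \in cut_words S n k t -> sm * t <= wratio S a <= t.
  move=> aC; apply/andP; split; first exact: cut_ratio_ge aC.
  exact: cut_ratio_le Hn aC.
have Mi : 0 < M^-1 by rewrite invr_gt0.
have [b1 b2] := andP (wsum_M k n).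
have := cut_wsum S s n k t => sumE.
exists (cut_words S n k t); split.
- exact: cut_uniq.
- exact: ratioC.
- have : (size (cut_words S n k t))%:R * ((sm * t) `^ s * M^-1) <= M.
    rewrite (le_trans _ b2)// -sumE; apply: ler_size_sum => a /ratioC/andP[ra _].
    have /andP[wM _] := wsum_M (k + size a) (n - size a).
    apply: ler_pM => //; [exact: powR_ge0|exact: ltW|].
    by rewrite ge0_ler_powR ?nnegrE ?(ltW s0)// (le_trans smt0).
  by rewrite mulrA ler_pdivrMr// expr2.
- have : M^-1 <= (size (cut_words S n k t))%:R * (t `^ s * M).
    rewrite (le_trans b1)// -sumE -lerN2 -sumrN -mulrN.
    apply: ler_size_sum => a /ratioC/andP[ra1 ra].
    have /andP[_ wM] := wsum_M (k + size a) (n - size a).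
    rewrite lerN2; apply: ler_pM => //; [exact: powR_ge0|exact/ltW/wsum_gt0|].
    by rewrite ge0_ler_powR ?nnegrE ?(ltW s0) ?(ltW t0)// (le_trans smt0).
  by rewrite mulrA -ler_pdivrMr// -invfM expr2.
- by move=> x Fx; apply: cut_cover => // j; rewrite -F_op.
- by move=> a aC; apply: (cut_image_sub _ aC) => j; rewrite -F_op.
- by move=> a b aC bC ab; exact: (cut_disjoint simS U_op U_disj aC bC ab).
Qed.

(** Points of U and F at one level are within D, so each f_w(U) lies in the ball of radius (D + 1)
    rho about y, where packing applies. The bound is uniform in k, rho and y. *)
Lemma moran_count (a : R) : 0 < a -> exists2 N : R, 0 < N &
  forall k rho y (r : seq (seq nat)), 0 < rho -> uniq r ->
  (forall w, w \in r -> a * rho <= wratio S w <= rho) ->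
  (forall w, w \in r ->
    exists2 p, F (k + size w)%N p & enorm (wmap S w p - y) <= rho) ->
  (forall v w, v \in r -> w \in r -> v != w ->
    (wmap S v @` U (k + size v)%N) `&` (wmap S w @` U (k + size w)%N) = set0) ->
  (size r)%:R <= N.
Proof.
move=> a0; have D2 : 0 < D + 1 by rewrite addr_gt0.
exists (2 * (16 * d%:R / (a / (D + 1))) ^+ d / eps).
  by rewrite divr_gt0// mulr_gt0// exprn_gt0// divr_gt0 ?divr_gt0 ?mulr_gt0 ?ltr0n.
move=> k rho y r rho0 ur ratio_r near_r disj_r.
apply: (@similar_packing_count _ _ y ((D + 1) * rho) eps (a / (D + 1)) _ r (wmap S)
  (wratio S) (fun w => U (k + size w)%N)) => //.
- exact: mulr_gt0.
- exact: divr_gt0.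
- move=> w /ratio_r/andP[aw _]; rewrite mulrA divfK ?gt_eqF//; split => //.
  exact: wmap_similarity.
- move=> w wr _ [u Uu <-]; have [p Fp py] := near_r _ wr.
  rewrite /ecball/= (le_trans (ler_enorm_dist (wmap S w p) _ _))//.
  rewrite mulrDl mul1r lerD// (wmap_similarity w simS) mulrC.
  have /andP[_ wrho] := ratio_r _ wr.
  by apply: ler_pM => //; [exact: enorm_ge0|exact/ltW/wratio_gt0|exact: (UF_D Uu Fp)].
Qed.

(** At most N pieces of size about delta meet the ball; each is cut into a multiple of (delta/rho)^s
    pieces of diameter at most rho, with one centre per piece. *)
Lemma covering_number_le (delta0 : R) k : 0 < delta0 -> exists2 C : R, 0 < C &
  forall delta rho : R, 0 < rho -> rho < delta -> delta <= delta0 -> forall x,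
  (covering_number (ecball x delta `&` F k) rho <= (C * (delta / rho) `^ s)%:E)%E.
Proof.
move=> dl0; pose d1 := 1 + delta0; have d11 : 1 <= d1 by rewrite /d1; lra.
have d10 : 0 < d1 by lra.
have [N N0 HN] := moran_count (divr_gt0 sm0 d10).
have smD : 0 < sm / D by rewrite divr_gt0.
have smDs : 0 < (sm / D) `^ s by rewrite powR_gt0.
exists (N * (M ^+ 2 / (sm / D) `^ s)).
  by rewrite !mulr_gt0// ?invr_gt0// exprn_gt0.
(* Stopping levels must be at most 1: dividing delta by 1 + delta0 ensures this for t. The factor D
   in u makes the final diameter t u D equal to rho / d1. *)
move=> delta rho rho0 rd dd0 x.
have de0 : 0 < delta by lra.
pose t := delta / d1.
have t0 : 0 < t by rewrite divr_gt0.
have t1 : t <= 1 by rewrite ler_pdivrMr// mul1r /d1; lra.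
have td : t <= delta by rewrite ler_pdivrMr// ler_peMr// ltW.
pose u := rho / (delta * D).
have dD0 : 0 < delta * D by rewrite mulr_gt0.
have u0 : 0 < u by rewrite divr_gt0.
have u1 : u <= 1.
  by rewrite ler_pdivrMr// mul1r (le_trans (ltW rd))// ler_peMr// ltW.
have [C HC] := stopping_set_exists k t0 t1.
have /choice[Cf HCf] : forall l, exists C, stopping_set l u C.
  by move=> l; exact: stopping_set_exists.
pose E := ecball x delta `&` F k.
pose A := [seq a <- C |
  `[< exists2 p, F (k + size a)%N p & enorm (wmap S a p - x) <= delta >]].
have AN : (size A)%:R <= N.
  apply: (HN k delta x) => //.
  - by rewrite filter_uniq// (stop_uniq HC).
  - move=> a; rewrite mem_filter => /andP[_ /(stop_ratio HC)/andP[ra1 ra2]].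
    by rewrite mulrAC -mulrA ra1 (le_trans ra2).
  - by move=> a; rewrite mem_filter => /andP[/asboolP].
  - move=> a b; rewrite !mem_filter => /andP[_ aC] /andP[_ bC].
    exact: stop_disj HC _ _ aC bC.
pose P := [seq a ++ b | a <- A, b <- Cf (k + size a)%N].
pose piece w := E `&` (wmap S w @` F (k + size w)%N).
(* Centres must lie in the covered set, so one is picked in each piece that meets it; the filter
   keeps the default x from being returned. *)
pose c := [seq xget x (piece w) | w <- P & `[< piece w !=set0 >]].
apply: ge_ereal_inf; exists (size c)%:R%:E; last first.
  rewrite lee_fin size_map size_filter (@le_trans _ _ (size P)%:R)//.
    by rewrite ler_nat count_size.
  rewrite size_allpairs_dep sumnE big_map natr_sum.
  have sizeCf l : (size (Cf l))%:R <= M ^+ 2 / (sm / D) `^ s * (delta / rho) `^ s.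
    have drs : 0 < (delta / rho) `^ s by rewrite powR_gt0// divr_gt0.
    rewrite mulrAC ler_pdivlMr//.
    have -> : (sm / D) `^ s = (sm * u) `^ s * (delta / rho) `^ s.
      rewrite -powRM ?mulr_ge0 ?divr_ge0 ?invr_ge0 ?(ltW sm0) ?(ltW u0) ?(ltW de0)
        ?(ltW rho0) ?(ltW dD0) ?(ltW D0)//.
      by congr (_ `^ _); rewrite /u; field; rewrite !gt_eqF.
    by rewrite mulrA ler_pM2r//; exact: stop_card_le.
  apply: (@le_trans _ _ ((size A)%:R * (M ^+ 2 / (sm / D) `^ s * (delta / rho) `^ s))).
    rewrite -lerN2 -sumrN -mulrN; apply: ler_size_sum => a _.
    by rewrite lerN2.
  rewrite -[N * _ * _]mulrA; apply: ler_wpM2r => //.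
  by rewrite mulr_ge0 ?powR_ge0// divr_ge0 ?powR_ge0// sqr_ge0.
exists c => //; split.
  move=> y /mapP[w]; rewrite mem_filter => /andP[/asboolP[z wz] _] ->.
  by case: (xgetPex x (ex_intro _ z wz)).
move=> y [xy Fy].
have [a aC [z Fz zy]] := stop_cover HC Fy.
have [b bC [v Fv vz]] := stop_cover (HCf (k + size a)%N) Fz.
have aA : a \in A.
  by rewrite mem_filter aC andbT; apply/asboolP; exists z => //; rewrite zy.
have wP : a ++ b \in P by apply/allpairsPdep; exists a, b.
have wy : wmap S (a ++ b) v = y by rewrite wmap_cat vz zy.
have Fv' : F (k + size (a ++ b))%N v by rewrite size_cat addnA.
have pw : piece (a ++ b) y by split; [split|exists v].
have [_ [v' Fv2 vy]] := xgetPex x (ex_intro _ y pw).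
exists (xget x (piece (a ++ b))).
  by apply/mapP; exists (a ++ b) => //; rewrite mem_filter wP andbT; apply/asboolP; exists y.
rewrite /ecball/= -vy -{1}wy (wmap_similarity _ simS) wratio_cat.
have /andP[_ ra] := stop_ratio HC aC.
have /andP[_ rb] := stop_ratio (HCf _) bC.
apply: (@le_trans _ _ (t * u * D)).
  apply: ler_pM; [|exact: enorm_ge0| |exact: (FF_D Fv' Fv2)].
    by rewrite mulr_ge0// ltW// wratio_gt0.
  by apply: ler_pM => //; exact/ltW/wratio_gt0.
have -> : t * u * D = rho / d1.
  by rewrite /t /u; field; rewrite !gt_eqF.
by rewrite ler_pdivrMr// ler_peMr// ltW.
Qed.

(** A piece through x of diameter at most delta lies in the ball. It splits into at least a multiple
    of (delta/rho)^s subpieces, and each ball of a cover meets at most N of them. *)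
Lemma covering_number_ge (delta0 : R) k : 0 < delta0 -> exists2 C : R, 0 < C &
  forall delta rho : R, 0 < rho -> rho < delta -> delta <= delta0 -> forall x, F k x ->
  ((C * (delta / rho) `^ s)%:E <= covering_number (ecball x delta `&` F k) rho)%E.
Proof.
move=> dl0; pose d1 := 1 + delta0; have d11 : 1 <= d1 by rewrite /d1; lra.
have d10 : 0 < d1 by lra.
have dD0 : 0 < d1 * D by rewrite mulr_gt0.
have dD1 : 1 <= d1 * D by rewrite mulr_ege1.
(* A subpiece has ratio at least (sm t)(sm u), which is this constant times rho. *)
have al0 : 0 < sm ^+ 2 / (d1 * D) by rewrite divr_gt0// exprn_gt0.
have [N N0 HN] := moran_count al0.
exists ((M ^+ 2)^-1 / N); first by rewrite divr_gt0// invr_gt0 exprn_gt0.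
move=> delta rho rho0 rd dd0 x Fx.
have de0 : 0 < delta by lra.
pose t := delta / (d1 * D).
have t0 : 0 < t by rewrite divr_gt0.
have t1 : t <= 1.
  by rewrite ler_pdivrMr// mul1r (@le_trans _ _ d1) ?ler_peMr ?(ltW d10)// /d1; lra.
pose u := rho / delta.
have u0 : 0 < u by rewrite divr_gt0.
have u1 : u <= 1 by rewrite ler_pdivrMr// mul1r ltW.
have tu : t * u = rho / (d1 * D) by rewrite /t /u; field; rewrite !gt_eqF.
have [C HC] := stopping_set_exists k t0 t1.
have [a aC [z Fz zx]] := stop_cover HC Fx.
have [B HB] := stopping_set_exists (k + size a) u0 u1.
have /andP[ra1 ra2] := stop_ratio HC aC.
apply: le_ereal_inf_tmp => _ [c [_ cE] <-]; rewrite lee_fin.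
pose Q (y : 'rV[R]_d) (b : seq nat) :=
  `[< exists2 p, F (k + size (a ++ b))%N p & enorm (wmap S (a ++ b) p - y) <= rho >].
have Bc b : b \in B -> exists2 y, y \in c & Q y b.
  move=> bB; have [p Fp] := F_neq0 (k + size a + size b).
  have Fbp : F (k + size a)%N (wmap S b p) by apply: (stop_sub HB bB); exists p.
  have Fabp : F k (wmap S (a ++ b) p).
    by rewrite wmap_cat; apply: (stop_sub HC aC); exists (wmap S b p).
  have /cE[y yc py] : (ecball x delta `&` F k) (wmap S (a ++ b) p).
    split => //; rewrite /ecball/= -zx wmap_cat (wmap_similarity a simS).
    apply: (@le_trans _ _ (t * D)).
      by apply: ler_pM => //; [exact/ltW/wratio_gt0|exact: enorm_ge0|exact: (FF_D Fbp Fz)].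
    have -> : t * D = delta / d1 by rewrite /t; field; rewrite !gt_eqF.
    by rewrite ler_pdivrMr// ler_peMr// ltW.
  by exists y => //; apply/asboolP; exists p => //; rewrite size_cat addnA.
have QN y : (count (Q y) B)%:R <= N.
  rewrite -size_filter -(size_map (cat a)); apply: (HN k rho y) => //.
  - rewrite map_inj_uniq ?filter_uniq ?(stop_uniq HB)// => b b' /eqP.
    by rewrite eqseq_cat// eqxx => /eqP.
  - move=> _ /mapP[b + ->]; rewrite mem_filter => /andP[_ /(stop_ratio HB)/andP[rb1 rb2]].
    rewrite wratio_cat; apply/andP; split.
      have -> : sm ^+ 2 / (d1 * D) * rho = sm * t * (sm * u).
        by rewrite mulrACA tu expr2 -!mulrA; congr (_ * (_ * _)); rewrite mulrC.
      by apply: ler_pM => //; rewrite mulr_ge0// ltW.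
    apply: (@le_trans _ _ (t * u)).
      by apply: ler_pM => //; exact/ltW/wratio_gt0.
    by rewrite tu ler_pdivrMr// ler_peMr// ltW.
  - by move=> _ /mapP[b + ->]; rewrite mem_filter => /andP[/asboolP].
  - move=> _ _ /mapP[b + ->] /mapP[b' + ->]; rewrite !mem_filter.
    move=> /andP[_ bB] /andP[_ b'B] bb'.
    have nbb' : b != b' by apply: contraNneq bb' => ->.
    apply/seteqP; split => // v [[p Up <-] [q Uq]] /= pq.
    have /seteqP[+ _] := stop_disj HB bB b'B nbb'; move/(_ (wmap S b p)); apply.
    split; first by exists p => //; rewrite -addnA -size_cat.
    exists q; first by rewrite -addnA -size_cat.
    by apply: (wmap_inj (w := a) simS); rewrite -!wmap_cat.
have BN : (size B)%:R <= (size c)%:R * N.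
  apply: (@le_trans _ _ (\sum_(y <- c) count (Q y) B)%:R).
    by rewrite ler_nat size_le_sum_count.
  rewrite natr_sum -lerN2 -sumrN -mulrN; apply: ler_size_sum => y _.
  by rewrite lerN2.
have := stop_card_ge HB => HBge.
rewrite mulrAC ler_pdivrMr// (le_trans _ BN)//.
have us : 0 < u `^ s by rewrite powR_gt0.
rewrite -(ler_pM2r us) -mulrA -powRM ?divr_ge0 ?(ltW de0) ?(ltW rho0) ?(ltW u0)//.
have -> : delta / rho * u = 1 by rewrite /u; field; rewrite !gt_eqF.
by rewrite powR1 mulr1.
Qed.

End Covering.

(** The quotient of the two constants gives equi-homogeneity with c1 = c2 = 1. The upper bound makes
    s admissible; the lower bound at delta = 1 excludes every s' < s as rho tends to 0. *)
Lemma assouad_dim_of_bounds (R : realType) (d : nat) (F : set 'rV[R]_d) (s : R) :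
  0 < s -> F !=set0 ->
  (forall delta0 : R, 0 < delta0 -> exists2 C : R, 0 < C &
    forall delta rho : R, 0 < rho -> rho < delta -> delta <= delta0 -> forall x, F x ->
    (covering_number (ecball x delta `&` F) rho <= (C * (delta / rho) `^ s)%:E)%E) ->
  (forall delta0 : R, 0 < delta0 -> exists2 c : R, 0 < c &
    forall delta rho : R, 0 < rho -> rho < delta -> delta <= delta0 -> forall x, F x ->
    ((c * (delta / rho) `^ s)%:E <= covering_number (ecball x delta `&` F) rho)%E) ->
  equi_homogeneous F /\ assouad_dim F = s%:E.
Proof.
move=> s0 [x0 Fx0] ub lb; split.
  move=> delta0 dl0; have [C C0 HC] := ub _ dl0; have [c c0 Hc] := lb _ dl0.
  exists (Num.max 1 (C / c)), 1, 1; split => //; first by rewrite le_max lexx.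
  move=> delta rho rho0 rd dd0.
  set X := (delta / rho) `^ s.
  have X0 : 0 <= X by exact: powR_ge0.
  apply: (@le_trans _ _ (C * X)%:E).
    by apply: ge_ereal_sup => _ [x Fx <-]; exact: HC.
  apply: (@le_trans _ _ ((Num.max 1 (C / c))%:E * (c * X)%:E)%E).
    rewrite -EFinM lee_fin mulrA ler_wpM2r// -ler_pdivrMr//.
    by rewrite le_max lexx orbT.
  apply: lee_wpmul2l; first by rewrite lee_fin le_max ler01.
  apply: le_ereal_inf_tmp => _ [x Fx <-]; rewrite !mul1r.
  exact: Hc.
apply/eqP; rewrite eq_le; apply/andP; split.
  apply: ge_ereal_inf; exists s%:E => //; exists s => //; split; first exact: ltW.
  move=> delta0 /ub[C C0 HC]; exists C => // delta rho rho0 rd dd0.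
  by apply: ge_ereal_sup => _ [x Fx <-]; exact: HC.
apply: le_ereal_inf_tmp => _ [s' [s'0 Hs'] <-]; rewrite lee_fin leNgt.
apply/negP => s's.
have [C C0 HC] := Hs' 1 ltr01; have [c c0 Hc] := lb 1 ltr01.
pose e := s - s'; have e0 : 0 < e by rewrite subr_gt0.
have bound (rho : R) : 0 < rho -> rho < 1 -> (1 / rho) `^ e <= C / c.
  move=> rho0 rho1; have : ((c * (1 / rho) `^ s)%:E <= (C * (1 / rho) `^ s')%:E)%E.
    apply: le_trans (Hc 1 rho rho0 rho1 (lexx _) x0 Fx0) _.
    apply: le_trans (HC 1 rho rho0 rho1 (lexx _)).
    by apply: ereal_sup_ubound; exists x0.
  have r0 : 0 < 1 / rho by rewrite divr_gt0.
  rewrite lee_fin -{1}(subrK s' s) powRD; last by apply/implyP => _; rewrite gt_eqF.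
  by rewrite mulrA ler_pM2r ?powR_gt0// mulrC -ler_pdivlMr.
(* For rho = B^(-1/e) < 1 the left side of [bound] equals B, which exceeds C / c. *)
pose B := C / c + 1; have B1 : 1 < B by rewrite /B ltrDr divr_gt0.
have B0 : 0 < B by rewrite (lt_trans ltr01).
have Be : 1 < B `^ e^-1.
  have <- : 1 `^ e^-1 = 1 :> R by rewrite powR1.
  apply: gt0_ltr_powR; rewrite ?nnegrE ?invr_gt0//.
  exact: ltW.
have := bound (B `^ e^-1)^-1.
rewrite invr_gt0 (lt_trans ltr01 Be) invf_lt1 ?(lt_trans ltr01 Be)// Be.
move=> /(_ isT isT).
rewrite invrK mul1r -powRrM mulVf ?gt_eqF// powRr1 ?(ltW B0)//.
by rewrite /B gerDl leNgt ltr01.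
Qed.

Theorem theorem1p7 (R : realType) (d : nat) (d_gt0 : (0 < d)%N)
    (S : nifs R d) (F : nat -> set 'rV[R]_d)
    (S_sim : similarities S)
    (F_attractor : pullback_attractor S F)
    (S_moran : moran_open_set_condition S)
    (sigma_star_gt0 : 0 < inf [set nifs_ratio S i | i in [set: nat]])
    (s : R) (n0 : nat) (L : R)
    (s_gt0 : 0 < s) (n0_gt0 : (0 < n0)%N) (L_gt0 : 0 < L)
    (sum_bounds : forall k n : nat, (0 < k)%N -> (n0 <= n)%N ->
      L^-1 <= \sum_(a \in words S k n) (word_ratio S a) `^ s <= L) :
  forall k : nat, equi_homogeneous (F k) /\ assouad_dim (F k) = s%:E.
Proof.
move=> k.
have [U [bU oU opU dU [eps eps0 epsU]]] := S_moran.
have [[_ bF] opF _] := F_attractor.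
have [MF MF0 HMF] := bounded_set_enorm bF.
have [MU MU0 HMU] := bounded_set_enorm bU.
have Fne := attractor_nonempty F_attractor.
have [M M1 HM] : exists2 M : R, 1 <= M & forall k n, M^-1 <= wsum S s k n <= M.
  by apply: (wsum_bounds (n0 := n0) L_gt0) => j n j0 nn; rewrite -fsum_wordsE; exact: sum_bounds.
(* One constant bounds both the diameters of the F^j and the distances between U^j and F^j; the 1
   gives D >= 1. *)
pose D := 1 + 2 * MF + MU.
have D1 : 1 <= D by rewrite /D; lra.
have FF j x y : F j x -> F j y -> enorm (x - y) <= D.
  move=> Fx Fy; rewrite (le_trans (ler_enormB _ _))// /D.
  have : enorm x <= MF by apply: HMF; exists j.
  have : enorm y <= MF by apply: HMF; exists j.
  lra.
have UF j x y : U j x -> F j y -> enorm (x - y) <= D.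
  move=> Ux Fy; rewrite (le_trans (ler_enormB _ _))// /D.
  have : enorm x <= MU by apply: HMU; exists j.
  have : enorm y <= MF by apply: HMF; exists j.
  lra.
have sm_le i : inf [set nifs_ratio S i | i in [set: nat]] <= nifs_ratio S i.
  apply: ge_inf; last by exists i.
  by exists 0 => _ [j _ <-]; exact/ltW/(ratio_gt0 S).
have small j t := @attractor_ratio_small _ _ _ _ F_attractor j t d_gt0 S_sim.
have oU1 j := (oU j).1.
apply: assouad_dim_of_bounds => // delta0 dl0.
  have [C C0 HC] := covering_number_le d_gt0 S_sim opF small oU1 opU dU eps0 epsU D1
    FF UF sigma_star_gt0 sm_le s_gt0 M1 HM k dl0.
  by exists C => // delta rho r0 rd dd x _; exact: HC.
have [C C0 HC] := covering_number_ge d_gt0 S_sim opF Fne small oU1 opU dU eps0 epsU D1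
  FF UF sigma_star_gt0 sm_le s_gt0 M1 HM k dl0.
by exists C => // delta rho r0 rd dd x Fx; exact: HC.
Qed.
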